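(* Let $\mathcal{C}$ be a minimal (nondegenerate) $[\mathbf{n},k]_{q^m/q}$ sum-rank metric code, where $\mathbf{n}=(n_1,\ldots,n_t)$ and $N=n_1+\cdots+n_t$, and let $w(\mathcal{C})$ denote the maximum sum-rank weight of the codewords of $\mathcal{C}$. Then \[ w(\mathcal{C})\leq N-k+1. \]
   Context: Let $q$ be a prime power, $m,t,k$ positive integers, $\mathbf{n}=(n_1,\ldots,n_t)$ a tuple of positive integers with $n_1\ge\cdots\ge n_t$, $N=n_1+\cdots+n_t$, and $\mathbb{F}_{q^m}^{\mathbf{n}}=\bigoplus_{i=1}^t\mathbb{F}_{q^m}^{n_i}$. The rank of $v=(v_1,\ldots,v_n)\in\mathbb{F}_{q^m}^n$ is $\mathrm{rk}(v)=\dim_{\mathbb{F}_q}\langle v_1,\ldots,v_n\rangle_{\mathbb{F}_q}$; the sum-rank weight of $x=(x_1,\ldots,x_t)\in\mathbb{F}_{q^m}^{\mathbf{n}}$ is $w(x)=\sum_{i=1}^t\mathrm{rk}(x_i)$, and the sum-rank distance is $d(x,y)=w(x-y)$. An $[\mathbf{n},k]_{q^m/q}$ (sum-rank metric) code is a $k$-dimensional $\mathbb{F}_{q^m}$-subspace $\mathcal{C}$ of $\mathbb{F}_{q^m}^{\mathbf{n}}$ with this distance. A generator matrix is $G=(G_1|\cdots|G_t)$, $G_i\in\mathbb{F}_{q^m}^{k\times n_i}$, whose rows form a basis of $\mathcal{C}$. $\mathcal{C}$ is nondegenerate if for each $i$ the columns of $G_i$ are $\mathbb{F}_q$-linearly independent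 (independent of the choice of $G$). All codes are assumed nondegenerate. Support: fix an $\mathbb{F}_q$-basis of $\mathbb{F}_{q^m}$; for $x_i\in\mathbb{F}_{q^m}^{n_i}$ let $\Gamma(x_i)\in\mathbb{F}_q^{n_i\times m}$ be the matrix whose $j$-th row consists of the coordinates of the $j$-th entry of $x_i$. The sum-rank support of $x$ is the tuple $(\mathrm{colsp}\,\Gamma(x_1),\ldots,\mathrm{colsp}\,\Gamma(x_t))$ of $\mathbb{F}_q$-column spaces, with $\mathrm{colsp}\,\Gamma(x_i)\subseteq\mathbb{F}_q^{n_i}$ (independent of the basis); inclusion of supports is componentwise. A codeword $c\in\mathcal{C}$ is minimal if every $c'\in\mathcal{C}$ whose support is contained in the support of $c$ satisfies $c'=\lambda c$ for some $\lambda\in\mathbb{F}_{q^m}$. $\mathcal{C}$ is minimal if all its codewords are minimal. *)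

(* Defs.v *)
From mathcomp Require Import all_boot all_order all_algebra all_field.

Set Implicit Arguments.
Unset Strict Implicit.
Unset Printing Implicit Defensive.

Import GRing.Theory.
Local Open Scope ring_scope.

(* F is the field F_q, L is F_{q^m}, and F_{q^m}^n is the space of row vectors
   of length N = \sum_i n i; the block x_i of x is submxrow x i. *)

Section SumRank.

Variables (F : finFieldType) (L : fieldExtType F).

Definition rk (n : nat) (v : 'rV[L]_n) : nat :=
  \dim <<[seq v ord0 j | j : 'I_n]>>%VS.

Section Support.

Variables (m : nat) (b : m.-tuple L).

Definition Gamma (n : nat) (v : 'rV[L]_n) : 'M[F]_(n, m) :=
  \matrix_(j < n, l < m) coord b l (v ord0 j).

Definition colsp (n : nat) (A : 'M[F]_(n, m)) : {vspace 'cV[F]_n} :=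
  <<[seq col l A | l : 'I_m]>>%VS.

End Support.

Variables (t : nat) (n : 'I_t -> nat).
Local Notation N := (\sum_i n i)%N.

Definition sr_weight (x : 'rV[L]_N) : nat := (\sum_i rk (submxrow x i))%N.

Definition sr_supp (m : nat) (b : m.-tuple L) (x : 'rV[L]_N) (i : 'I_t) :
    {vspace 'cV[F]_(n i)} :=
  colsp (Gamma b (submxrow x i)).

(* finvect_type L is L itself, equipped with its finite type structure. *)
Definition max_weight (C : {vspace 'rV[L]_N}) : nat :=
  (\max_(c : 'rV[finvect_type L]_N | (c : 'rV[L]_N) \in C)
     sr_weight (c : 'rV[L]_N))%N.

Definition generator_mx (k : nat) (C : {vspace 'rV[L]_N}) (G : 'M[L]_(k, N)) :
    bool :=
  basis_of C [seq row r G | r : 'I_k].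

(* A column is written as a finite function, since {ffun 'I_k -> L} is
   canonically a vector space over F whereas 'cV[L]_k is one over L only. *)
Definition F_column (k p : nat) (A : 'M[L]_(k, p)) (j : 'I_p) :
    {ffun 'I_k -> L} :=
  [ffun r => A r j].

(* The condition on G does not depend on the choice of generator matrix. *)
Definition nondegenerate_code (k : nat) (C : {vspace 'rV[L]_N}) : Prop :=
  exists G : 'M[L]_(k, N), generator_mx C G /\
    forall i : 'I_t, @free F _ [seq F_column (submxrow G i) j | j : 'I_(n i)].

Definition minimal_codeword (m : nat) (b : m.-tuple L) (C : {vspace 'rV[L]_N})
    (c : 'rV[L]_N) : Prop :=
  forall c' : 'rV[L]_N, c' \in C ->
    (forall i : 'I_t, (sr_supp b c' i <= sr_supp b c i)%VS) ->
    exists lambda : L, c' = lambda *: c.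

Definition minimal_code (m : nat) (b : m.-tuple L) (C : {vspace 'rV[L]_N}) :
    Prop :=
  forall c : 'rV[L]_N, c \in C -> minimal_codeword b C c.

End SumRank.

(* Main.v *)
Require Import Defs.
From mathcomp Require Import all_boot all_order all_algebra all_field.

Set Implicit Arguments.
Unset Strict Implicit.
Unset Printing Implicit Defensive.

(** The vectors whose support is contained in that of a codeword [c] of weight
    [w] form an [L]-space of dimension (at least) [w], because the rank of a
    matrix over [F] does not change over [L].  By minimality this space meets
    [C] in a subspace of the line spanned by [c], so [w + k - N <= 1]. *)

Import GRing.Theory.

Section SumRankWeight.

Local Open Scope ring_scope.

Section SupportSpace.

Variables (F : finFieldType) (L : fieldExtType F) (m : nat) (b : m.-tuple L).
Hypothesis hb : basis_of fullv b.

Lemma mulmx_Gamma (n : nat) (v : 'rV[L]_n) :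
  v = (\row_l b`_l) *m map_mx (in_alg L) (Gamma b v)^T.
Proof.
apply/rowP => j; rewrite !mxE {1}(coord_basis hb (memvf (v ord0 j))).
by apply: eq_bigr => l _; rewrite !mxE mulr_algr.
Qed.

(** A rank factorization of [(Gamma b v)^T] over [F] makes every entry of [v] an [F]-combination of
    the entries of [u], of which there are only [\rank A]. *)
Lemma rk_leq_rank_Gamma (n : nat) (v : 'rV[L]_n) :
  (rk v <= \rank (Gamma b v)^T)%N.
Proof.
set A := (Gamma b v)^T.
pose u := (\row_l b`_l) *m map_mx (in_alg L) (col_base A).
have vE : v = u *m map_mx (in_alg L) (row_base A).
  by rewrite -mulmxA -map_mxM mulmx_base -mulmx_Gamma.
apply: leq_trans (_ : \dim <<[seq u ord0 s | s : 'I_(\rank A)]>>%VS <= _)%N.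
  apply/dimvS/span_subvP => _ /imageP[j _ ->]; rewrite vE mxE.
  apply: rpred_sum => s _; rewrite [X in _ * X]mxE mulr_algr.
  exact/rpredZ/memv_span/image_f.
by apply: leq_trans (dim_span _) _; rewrite size_image card_ord.
Qed.

(** Coordinates are [F]-linear and [Gamma b v] has entries in [F], so each new column is an
    [F]-combination of the old ones, with coordinates of the entries of [y] as coefficients. *)
Lemma colsp_Gamma_mulmx (n : nat) (v : 'rV[L]_n) (y : 'rV[L]_m) :
  (colsp (Gamma b (y *m map_mx (in_alg L) (Gamma b v)^T))
     <= colsp (Gamma b v))%VS.
Proof.
apply/span_subvP => _ /imageP[l _ ->].
have -> : col l (Gamma b (y *m map_mx (in_alg L) (Gamma b v)^T)) =
    \sum_s coord b l (y ord0 s) *: col s (Gamma b v).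
  apply/colP => j; rewrite summxE !mxE linear_sum.
  by apply: eq_bigr => s _; rewrite !mxE mulr_algr linearZ mulrC.
by apply: rpred_sum => s _; apply/rpredZ/memv_span/image_f.
Qed.

End SupportSpace.

Lemma basis_row_free (K : fieldType) (k N : nat) (C : {vspace 'rV[K]_N})
    (G : 'M[K]_(k, N)) :
  basis_of C [seq row r G | r : 'I_k] -> row_free G.
Proof.
move=> /basis_free freeG; apply: inj_row_free => u uG0.
(* [freeP] indexes this family by ['I_#|'I_k|], so the coefficients [u] are transported along
   [enum_val]. *)
have /freeP coefs0 : free (image_tuple (fun r => row r G) 'I_k) by [].
apply/rowP => r; rewrite mxE -[r]enum_rankK.
apply: (coefs0 (fun j => u ord0 (enum_val j))).
rewrite -[RHS]uG0 mulmx_sum_row.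
rewrite [RHS](reindex_onto enum_val enum_rank) => [|i _]; last first.
  by rewrite enum_rankK.
apply: eq_big => [j|j _]; first by rewrite enum_valK eqxx.
by rewrite nth_image.
Qed.

Lemma minimal_sr_weight (F : finFieldType) (L : fieldExtType F) (m : nat)
    (b : m.-tuple L) (t k : nat) (n : 'I_t -> nat)
    (C : {vspace 'rV[L]_(\sum_i n i)}) (G : 'M[L]_(k, \sum_i n i))
    (c : 'rV[L]_(\sum_i n i)) :
  basis_of fullv b -> generator_mx C G -> minimal_codeword b C c ->
  (sr_weight c + k <= \sum_i n i + 1)%N.
Proof.
move=> hb basisG min_c.
pose A i := map_mx (in_alg L) (Gamma b (submxrow c i))^T.
(* Diagonal blocks must be square: [<<A i>>] is a square matrix with the row space of [A i]. *)
pose M := \mxdiag_i <<A i>>%MS.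
have rankG : \rank G = k by apply/eqP; exact: (basis_row_free basisG).
have weight_leq : (sr_weight c <= \rank M)%N.
  rewrite rank_mxdiag; apply: leq_sum => i _.
  by rewrite mxrank_gen mxrank_map rk_leq_rank_Gamma.
have capGM : (G :&: M <= c)%MS.
  apply/rV_subP => x; rewrite sub_capmx => /andP[/submxP[u xE] /submxP[y xyE]].
  have [||lambda ->] := min_c x.
  - rewrite xE mulmx_sum_row -(span_basis basisG).
    by apply: rpred_sum => r _; apply/rpredZ/memv_span/image_f.
  - move=> i; rewrite /sr_supp.
    have /submxP[z ->] : (submxrow x i <= A i)%MS.
      rewrite xyE -[y]submxrowK mul_mxrow_mxdiag mxrowK.
      by apply: submx_trans (submxMl _ _) _; rewrite genmxE.
    exact: colsp_Gamma_mulmx.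
  - exact: scalemx_sub.
(* The ranks of [G] and [M] add up to those of their sum and their intersection: the former is at
   most the number of columns, the latter at most 1 since [c] is a single row. *)
apply: leq_trans (leq_add weight_leq (eq_leq (esym rankG))) _.
rewrite addnC -mxrank_sum_cap leq_add ?rank_leq_col //.
exact: leq_trans (mxrankS capGM) (rank_leq_row _).
Qed.

End SumRankWeight.

Theorem theorem2p4 (F : finFieldType) (L : fieldExtType F) (m : nat)
    (b : m.-tuple L) (hb : basis_of fullv b)
    (t k : nat) (ht : 0 < t) (hk : 0 < k)
    (n : 'I_t -> nat) (n_gt0 : forall i : 'I_t, 0 < n i)
    (n_noninc : forall i j : 'I_t, i <= j -> n j <= n i)
    (C : {vspace 'rV[L]_(\sum_i n i)}) (dimC : \dim C = k)
    (C_nondeg : nondegenerate_code k C)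
    (C_min : minimal_code b C) :
  max_weight C <= \sum_i n i - k + 1.
Proof.
have [G [basisG _]] := C_nondeg.
apply/bigmax_leqP => c Cc.
have := minimal_sr_weight hb basisG (C_min c Cc).
(* Subtraction is truncated at 0, so this bound is what lets [k] cross the inequality. *)
have leq_kN : k <= \sum_i n i.
  by rewrite -dimC (leq_trans (dimvS (subvf C))) // dimvf /dim /= mul1n.
by rewrite addnBAC // leq_subRL 1?addnC // (leq_trans leq_kN) ?leq_addr.
Qed.
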